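(* Suppose the design is balanced, i.e. $n_0=n_1=\cdots=n_k$, and let $\alpha\in(0,1)$. Let $$R_1=\left\{\frac{\hat{\mu}_1-\bar{Y}_0-\delta}{S}>t_{\alpha,\nu}\sqrt{1/n_1+1/n_0}\right\}$$ be the region on which the proposed step-up test claims $MED=1$, and let $$\{T_1^{HB}=1\}=\left\{\min_{i\in[1,k]}\frac{\bar{Y}_i-\bar{Y}_0-\delta}{S\sqrt{1/n_i+1/n_0}}>t_{\alpha,\nu}\right\}$$ be the region on which Hsu and Berger's test claims $MED=1$. Then $R_1\supseteq\{T_1^{HB}=1\}$. Therefore the proposed test is uniformly more powerful than Hsu and Berger's when the $MED$ equals $1$: for every parameter value with $\mu_1>\mu_0+\delta$, $P(R_1)\ge P(T_1^{HB}=1)$.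
   Context: Integer intervals: $[a,b]$ denotes the set of integers from $a$ to $b$. Model: $Y_{ij}=\mu_i+\varepsilon_{ij}$ for $i=0,\dots,k$, $j=1,\dots,n_i$, with independent errors $\varepsilon_{ij}\sim N(0,\sigma^2)$, $\sigma^2$ unknown, and parameter space $H=\{(\mu_0,\mu_1,\dots,\mu_k):\mu_1\le\cdots\le\mu_k\}$. $\bar{Y}_i$ are the sample means, $S^2$ is the mean squared error with $\nu=\sum_{i=0}^k n_i-(k+1)$ degrees of freedom, and $S>0$ its square root. $\delta\ge0$ is a given constant; the minimum effective dose $MED$ is the smallest positive integer $N$ with $\mu_N>\mu_0+\delta$. $t_{\alpha,\nu}$ is the upper $\alpha$ quantile of the $t$-distribution with $\nu$ degrees of freedom. For $1\le i\le j\le k$ put $n_{i,j}=\sum_{h=i}^j n_h$ and $\bar{Y}_{i,j}=\frac{1}{n_{i,j}}\sum_{h=i}^j n_h\bar{Y}_h$. SDMMSA estimators $\hat{\mu}_1,\dots,\hat{\mu}_k$: set $i_0=k+1$. Given $i_{u-1}>1$, let $i_u$ be the smallest $j\in[1,i_{u-1}-1]$ such that $\bar{Y}_{j,i_{u-1}-1}=\max_{1\le j'\le i_{u-1}-1}\bar{Y}_{j',i_{u-1}-1}$, and define $\hat{\mu}_i=\bar{Y}_{i_u,i_{u-1}-1}$ for all $i\in[i_u,i_{u-1}-1]$. Stop at the first $u=h$ with $i_h=1$. *)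

(* Defs.v *)
From HB Require Import structures.
From mathcomp Require Import all_boot all_order all_algebra.
From mathcomp Require Import all_classical all_reals all_analysis.

Set Implicit Arguments.
Unset Strict Implicit.
Unset Printing Implicit Defensive.
Import Order.TTheory GRing.Theory Num.Theory.
Import numFieldNormedType.Exports.
Local Open Scope classical_set_scope.
Local Open Scope ring_scope.

(** Student's t-distribution. *)

(* Density of the t-distribution with nu degrees of freedom, up to its
   normalizing constant. *)
Definition student_kernel {R : realType} (nu : nat) (x : R) : R :=
  (1 + x ^+ 2 / nu%:R) `^ (- ((nu%:R + 1) / 2)).

(* The constant Gamma((nu+1)/2) / (sqrt (nu pi) Gamma(nu/2)) is written as the
   reciprocal of the total mass of the kernel. *)
Definition student_pdf {R : realType} (nu : nat) (x : R) : R :=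
  student_kernel nu x / Rintegral lebesgue_measure setT (@student_kernel R nu).

(* P(T > t) for T t-distributed with nu degrees of freedom *)
Definition student_upper_tail {R : realType} (nu : nat) (t : R) : \bar R :=
  (\int[lebesgue_measure]_(x in `]t, +oo[) (student_pdf nu x)%:E)%E.

(* t_{alpha,nu}: the upper alpha quantile. *)
Definition t_quantile {R : realType} (alpha : R) (nu : nat) : R :=
  inf [set t : R | (student_upper_tail nu t <= alpha%:E)%E].

(** Data and statistics. Group 0 is the control, groups 1, ..., k are the
    increasing doses, and n i is the sample size of group i. *)

Definition sample (R : realType) (k : nat) (n : 'I_k.+1 -> nat) : Type :=
  forall i : 'I_k.+1, 'I_(n i) -> R.

Definition dof (k : nat) (n : 'I_k.+1 -> nat) : nat :=
  (\sum_(i < k.+1) n i - k.+1)%N.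

Definition mean {R : realType} {k : nat} (n : 'I_k.+1 -> nat)
    (y : sample R n) (i : 'I_k.+1) : R :=
  (\sum_(j < n i) y i j) / (n i)%:R.

Definition mse {R : realType} {k : nat} (n : 'I_k.+1 -> nat)
    (y : sample R n) : R :=
  (\sum_(i < k.+1) \sum_(j < n i) (y i j - mean y i) ^+ 2) / (dof n)%:R.

Section statistics.
Context {R : realType} {k : nat} (n : 'I_k.+1 -> nat) (y : sample R n).
Implicit Types (i : 'I_k.+1) (a b m u g : nat).

Definition rmse : R := Num.sqrt (mse y).

(* n_{a,b} and Ybar_{a,b}: groups a, ..., b pooled *)
Definition pooled_size a b : nat := \sum_(h < k.+1 | (a <= h <= b)%N) n h.

Definition pooled_mean a b : R :=
  (\sum_(h < k.+1 | (a <= h <= b)%N) (n h)%:R * mean y h)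
    / (pooled_size a b)%:R.

(* The smallest a in [1, m] maximizing Ybar_{a,m}; it is 1 when m = 0. *)
Definition block_start m : nat :=
  head 1%N [seq a <- iota 1 m |
    all (fun a' => pooled_mean a' m <= pooled_mean a m) (iota 1 m)].

(* i_u; once i_u = 1 is reached the sequence stays constant, which encodes
   the stopping rule. *)
Fixpoint sdmmsa_index u : nat :=
  if u is v.+1 then block_start (sdmmsa_index v).-1 else k.+1.

(* The number u >= 1 of the block [i_u, i_(u-1) - 1] containing g in [1, k]:
   the first u with i_u <= g. *)
Definition sdmmsa_block g : nat :=
  find (fun u => (sdmmsa_index u <= g)%N) (iota 0 k.+1).

(* The SDMMSA estimator of mu_g, for g in [1, k]. *)
Definition sdmmsa g : R :=
  let u := sdmmsa_block g in
  pooled_mean (sdmmsa_index u) (sdmmsa_index u.-1).-1.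

Definition HB_ratio (delta : R) i : R :=
  (mean y i - mean y ord0 - delta)
    / (rmse * Num.sqrt ((n i)%:R^-1 + (n ord0)%:R^-1)).

End statistics.

(** Rejection regions, as sets of data. [inord 1] is dose 1 (used with
    0 < k). *)

(* R_1: the step-up test claims MED = 1. *)
Definition stepup_region {R : realType} {k : nat} (n : 'I_k.+1 -> nat)
    (alpha delta : R) : set (sample R n) :=
  [set y | (sdmmsa y 1 - mean y ord0 - delta) / rmse y >
     t_quantile alpha (dof n) *
       Num.sqrt ((n (inord 1))%:R^-1 + (n ord0)%:R^-1)].

(* {T_1^HB = 1}: Hsu and Berger's test claims MED = 1. The minimum over doses
   1, ..., k is initialized at the ratio of dose 1. *)
Definition HB_region {R : realType} {k : nat} (n : 'I_k.+1 -> nat)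
    (alpha delta : R) : set (sample R n) :=
  [set y | \big[Num.min/HB_ratio y delta (inord 1)]_(i < k.+1 | (0 < i)%N)
      HB_ratio y delta i > t_quantile alpha (dof n)].

(** Parameters and model. *)

(* The parameter space H; mu_0 is unconstrained. *)
Definition ordered_means {R : realType} {k : nat} (mu : 'I_k.+1 -> R) : Prop :=
  forall i j : 'I_k.+1, (0 < i)%N -> (i <= j)%N -> mu i <= mu j.

Definition is_MED {R : realType} {k : nat} (mu : 'I_k.+1 -> R) (delta : R)
    (N : 'I_k.+1) : Prop :=
  [/\ (0 < N)%N, mu N > mu ord0 + delta &
      forall i : 'I_k.+1, (0 < i)%N -> mu i > mu ord0 + delta -> (N <= i)%N].

Definition mutually_independent {d : measure_display} {T : measurableType d}
    {R : realType} (P : probability T R) (I : finType)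
    (X : I -> {RV P >-> R}) : Prop :=
  forall (J : {set I}) (A : I -> set R), (forall i, measurable (A i)) ->
    P (\bigcap_(i in [set i | i \in J]) (X i @^-1` A i)) =
    (\prod_(i in J) P (X i @^-1` A i))%E.

(* The errors eps_ij are mutually independent with law N(0, sigma^2); the
   second argument of [normal_prob] is the standard deviation. *)
Definition normal_errors {d : measure_display} {T : measurableType d}
    {R : realType} (P : probability T R) {k : nat} (n : 'I_k.+1 -> nat)
    (sigma : R) (eps : forall i : 'I_k.+1, 'I_(n i) -> {RV P >-> R}) : Prop :=
  mutually_independent
    (fun ij : {i : 'I_k.+1 & 'I_(n i)} => eps (tag ij) (tagged ij)) /\
  forall (i : 'I_k.+1) (j : 'I_(n i)) (A : set R), measurable A ->
    distribution P (eps i j) A = normal_prob 0 sigma A.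

(* Y_ij = mu_i + eps_ij *)
Definition observations {d : measure_display} {T : measurableType d}
    {R : realType} {P : probability T R} {k : nat} {n : 'I_k.+1 -> nat}
    (mu : 'I_k.+1 -> R) (eps : forall i : 'I_k.+1, 'I_(n i) -> {RV P >-> R})
    (w : T) : sample R n :=
  fun i j => mu i + eps i j w.

(* Main.v *)
Require Import Defs.
From HB Require Import structures.
From mathcomp Require Import all_boot all_order all_algebra.
From mathcomp Require Import all_classical all_reals all_analysis.
From mathcomp Require Import measurable_realfun.
From mathcomp Require Import zify lra.

(** The SDMMSA estimate of the first dose is the pooled mean of the block that
    contains dose 1, that is of doses 1, ..., m for some m in [1, k]
    ([sdmmsa_dose1]).  In a balanced design the standard error
    c = sqrt (1/n_i + 1/n_0) does not depend on the dose i.  Hence, when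
    S > 0, Hsu and Berger's test claims MED = 1 exactly when every dose mean
    exceeds the single bound Ybar_0 + delta + t S c ([HB_ratio_gt]).  A weighted
    average of numbers above a bound is above it ([lt_pooled_mean]), so the
    estimate exceeds that bound too, which is the step-up criterion.  When
    S = 0, division by S gives 0 and both tests reduce to the condition t < 0.

    The comparison of probabilities is the monotonicity of P, which requires
    both regions to be events.  The ratios are built from the data by sums,
    products, a square root, an inverse and minima.  In the estimator,
    moreover, the data choose the indices of the block.  These indices are
    measurable maps into nat, and selecting by such an index from a sequence
    of measurable functions gives a measurable function, because the possible
    values of the index partition the sample space into countably many events
    ([measurable_fun_select]). *)

Set Implicit Arguments.
Unset Strict Implicit.
Unset Printing Implicit Defensive.
Import Order.TTheory GRing.Theory Num.Theory.
Import numFieldNormedType.Exports.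
Local Open Scope classical_set_scope.
Local Open Scope ring_scope.

(** * The block containing the first dose *)

Section first_block.
Context {R : realType} {k : nat} (n : 'I_k.+1 -> nat) (y : sample R n).

Lemma block_start_ge1 m : (1 <= block_start y m)%N.
Proof.
rewrite /block_start; set s := (X in head _ X).
have : all (leq 1) s.
  by apply/allP => a; rewrite mem_filter mem_iota => /andP[_ /andP[]].
by case: s => //= a s /andP[].
Qed.

Lemma block_start_le m : (0 < m)%N -> (block_start y m <= m)%N.
Proof.
move=> m0; rewrite /block_start; set s := (X in head _ X).
have : all (leq^~ m) s.
  by apply/allP => a; rewrite mem_filter mem_iota add1n ltnS => /and3P[].
by case: s => //= a s /andP[].
Qed.

Lemma sdmmsa_index_ge1 u : (1 <= sdmmsa_index y u)%N.
Proof. by case: u => //= u; exact: block_start_ge1. Qed.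

(** The block boundaries decrease strictly until they reach 1, which therefore
    happens after at most k steps. *)
Lemma sdmmsa_index_le u : (sdmmsa_index y u <= maxn 1 (k.+1 - u))%N.
Proof.
elim: u => [|u IH]; first by rewrite subn0 leq_max leqnn orbT.
rewrite /=; set m := (sdmmsa_index y u).-1.
have [m0|m0] := posnP m; first by rewrite m0 leq_max.
apply: leq_trans (block_start_le m0) _.
by move: IH m0; rewrite /m; lia.
Qed.

(** The block of dose 1 is the first one whose left end is at most 1, so its
    left end is 1, and the left end of the block found before it exceeds 1, so
    its right end m is at least 1. *)
Lemma sdmmsa_dose1 : (0 < k)%N ->
  exists2 m, (1 <= m <= k)%N & sdmmsa y 1 = pooled_mean y 1 m.
Proof.
move=> k0; rewrite /sdmmsa /sdmmsa_block; set p := (X in find X _).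
have hp : has p (iota 0 k.+1).
  apply/hasP; exists k; first by rewrite mem_iota /= add0n ltnSn.
  by have := sdmmsa_index_le k; rewrite /p; lia.
have := nth_find 0%N hp; rewrite has_find size_iota in hp.
case E : (find p _) => [|u].
  (* Index 0 is k + 1 > 1, so the search cannot stop there. *)
  by rewrite nth_iota // /p /=; lia.
rewrite E in hp; rewrite nth_iota // add0n {1}/p => hu1.
have := @before_find _ 0%N p (iota 0 k.+1) u.
rewrite E nth_iota; last exact: ltnW.
rewrite add0n /p => /(_ (ltnSn u)) hu.
have -> : sdmmsa_index y u.+1 = 1%N.
  by apply/eqP; rewrite eqn_leq hu1 sdmmsa_index_ge1.
exists (sdmmsa_index y u).-1 => //.
by have := sdmmsa_index_le u; move: hu; lia.
Qed.

Lemma lt_pooled_mean (c : R) a b : (a <= b <= k)%N ->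
  (forall h : 'I_k.+1, (0 < n h)%N) ->
  (forall h : 'I_k.+1, (a <= h <= b)%N -> c < mean y h) ->
  c < pooled_mean y a b.
Proof.
move=> /andP[ab bk] n0 cy.
have bk1 : (b < k.+1)%N by [].
have bP : (a <= Ordinal bk1 <= b)%N by rewrite /= ab leqnn.
have size_gt0 : (0 < pooled_size n a b)%N.
  by rewrite /pooled_size (bigD1 (Ordinal bk1)) //= ltn_addr.
rewrite /pooled_mean ltr_pdivlMr ?ltr0n // /pooled_size natr_sum mulr_sumr.
rewrite [ltLHS](bigD1 (Ordinal bk1)) // [ltRHS](bigD1 (Ordinal bk1)) //=.
apply: ltr_leD.
  by rewrite mulrC ltr_pM2l ?ltr0n //; exact: cy.
apply: ler_sum => h /andP[hP _].
by rewrite mulrC ler_pM2l ?ltr0n // ltW // cy.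
Qed.

(** * Inclusion of the regions *)

Lemma rmse_ge0 : 0 <= rmse y.
Proof. exact: sqrtr_ge0. Qed.

Lemma HB_ratio_gt (delta t : R) i (c := Num.sqrt ((n i)%:R^-1 + (n ord0)%:R^-1)) :
  (0 < n i)%N -> 0 < rmse y ->
  (t < HB_ratio y delta i) = (mean y ord0 + delta + t * rmse y * c < mean y i).
Proof.
move=> ni S0.
have c0 : 0 < c.
  by rewrite sqrtr_gt0 ltr_pwDl ?invr_gt0 ?ltr0n // invr_ge0.
rewrite /HB_ratio -/c ltr_pdivlMr ?mulr_gt0 // mulrA.
by apply/idP/idP; lra.
Qed.

(** Balance makes the lower bounds that the test of Hsu and Berger puts on the
    dose means coincide, and a common lower bound passes to the pooled mean. *)
Lemma HB_region_sub_stepup (alpha delta : R) : (0 < k)%N ->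
  (forall i, 0 < n i)%N -> (forall i, n i = n ord0) ->
  HB_region alpha delta y -> stepup_region alpha delta y.
Proof.
move=> k0 n0 nE; rewrite /HB_region /stepup_region /=.
set t := t_quantile _ _ => /bigmin_gtP[t1 ti].
set c := Num.sqrt _.
have cE i : Num.sqrt ((n i)%:R^-1 + (n ord0)%:R^-1) = c.
  by rewrite /c (nE i) (nE (inord 1)).
have c0 : 0 < c.
  by rewrite sqrtr_gt0 ltr_pwDl ?invr_gt0 ?ltr0n // invr_ge0.
have := rmse_ge0; rewrite le_eqVlt => /predU1P[S0|S0].
  (* Here S = 0 and all quotients by S are 0: both criteria say t < 0. *)
  move: t1; rewrite /HB_ratio -S0 mul0r invr0 !mulr0.
  by rewrite pmulr_llt0.
have [m /andP[m1 mk] ->] := sdmmsa_dose1 k0.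
rewrite ltr_pdivlMr //.
have : mean y ord0 + delta + t * rmse y * c < pooled_mean y 1 m.
  apply: lt_pooled_mean => // [|h /andP[h1 _]]; first by rewrite m1.
  by rewrite -(cE h) -HB_ratio_gt //; exact: ti.
lra.
Qed.

End first_block.

(** * Measurability of the regions *)

Section measurability.
Context {d : measure_display} {T : measurableType d}.

(** The preimage of A is the countable union over m of the events on which the
    index is m and g m takes its value in A. *)
Lemma measurable_fun_select d' (U : measurableType d') (f : T -> nat)
    (g : nat -> T -> U) :
  measurable_fun setT f -> (forall m, measurable_fun setT (g m)) ->
  measurable_fun setT (fun w => g (f w) w).
Proof.
move=> mf mg _ A mA; rewrite setTI.
have -> : (fun w => g (f w) w) @^-1` A =
    \bigcup_m (f @^-1` [set m] `&` g m @^-1` A).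
  apply/seteqP; split => [w Aw|w [m _ [/= <-]]] //.
  by exists (f w).
apply: bigcupT_measurable => m; apply: measurableI.
  by rewrite -[X in measurable X]setTI; exact: mf.
by rewrite -[X in measurable X]setTI; exact: mg.
Qed.

(** The list searched is fixed, and the data enter only through the test applied
    to its elements, so induction on the list reduces the search to finitely many
    measurable case distinctions. *)
Lemma measurable_fun_find (p : nat -> T -> bool) (s : seq nat) :
  (forall a, measurable_fun setT (p a)) ->
  measurable_fun setT (fun w => find (p^~ w) s).
Proof.
move=> mp; elim: s => [|a s IH] /=; first exact: measurable_cst.
apply: measurable_fun_ifT => //.
exact: (measurable_fun_select IH (fun m => @measurable_cst _ _ _ _ setT m.+1)).
Qed.

Lemma measurable_fun_head_filter (p : nat -> T -> bool) (x : nat) (s : seq nat) :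
  (forall a, measurable_fun setT (p a)) ->
  measurable_fun setT (fun w => head x [seq a <- s | p a w]).
Proof.
move=> mp; elim: s => [|a s IH] /=; first exact: measurable_cst.
under eq_fun do rewrite (fun_if (head x)) /=.
exact: measurable_fun_ifT.
Qed.

Lemma measurable_fun_all (p : nat -> T -> bool) (s : seq nat) :
  (forall a, measurable_fun setT (p a)) ->
  measurable_fun setT (fun w => all (p^~ w) s).
Proof.
move=> mp; elim: s => [|a s IH] /=; first exact: measurable_cst.
exact: measurable_and.
Qed.

Context {R : realType}.

Lemma measurable_sum_cond (I : Type) (s : seq I) (P : pred I) (f : I -> T -> R) :
  (forall i, measurable_fun setT (f i)) ->
  measurable_fun setT (fun w => \sum_(i <- s | P i) f i w).
Proof.
move=> mf; under eq_fun do rewrite big_mkcond.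
by apply: measurable_sum => i; case: (P i); [|exact: measurable_cst].
Qed.

Lemma measurable_bigmin (I : Type) (s : seq I) (P : pred I) (f : I -> T -> R)
    (f0 : T -> R) :
  measurable_fun setT f0 -> (forall i, measurable_fun setT (f i)) ->
  measurable_fun setT (fun w => \big[Num.min/f0 w]_(i <- s | P i) f i w).
Proof.
move=> mf0 mf; elim: s => [|i s IH].
  by under eq_fun do rewrite big_nil.
under eq_fun do rewrite big_cons.
by case: (P i) => //; exact: measurable_minr.
Qed.

Context {k : nat} (n : 'I_k.+1 -> nat) (y : T -> sample R n)
  (measurable_data : forall i j, measurable_fun setT (fun w => @y w i j)).

Lemma measurable_mean i : measurable_fun setT (fun w => mean (y w) i).
Proof.
apply: measurable_funM; last exact: measurable_cst.
by apply: measurable_sum => j; exact: measurable_data.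
Qed.

Lemma measurable_rmse : measurable_fun setT (fun w => rmse (y w)).
Proof.
apply: (measurableT_comp (continuous_measurable_fun (@sqrt_continuous R))).
apply: measurable_funM; last exact: measurable_cst.
apply: measurable_sum => i; apply: measurable_sum => j.
apply: measurable_funX; apply: measurable_funB; first exact: measurable_data.
exact: measurable_mean.
Qed.

(** The inverse is discontinuous at 0, but on nonnegative numbers it is the
    power function of exponent -1, which is measurable. *)
Lemma measurable_div_rmse (f : T -> R) (c : R) : 0 <= c ->
  measurable_fun setT f -> measurable_fun setT (fun w => f w / (rmse (y w) * c)).
Proof.
move=> c0 mf; apply: measurable_funM => //.
under eq_fun do rewrite -powR_inv1 ?mulr_ge0 ?rmse_ge0 //.
apply: (measurableT_comp (measurable_powR _)).
apply: measurable_funM; [exact: measurable_rmse|exact: measurable_cst].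
Qed.

Lemma measurable_pooled_mean a b :
  measurable_fun setT (fun w => pooled_mean (y w) a b).
Proof.
apply: measurable_funM; last exact: measurable_cst.
apply: measurable_sum_cond => h.
apply: measurable_funM; [exact: measurable_cst|exact: measurable_mean].
Qed.

Lemma measurable_block_start m :
  measurable_fun setT (fun w => block_start (y w) m).
Proof.
apply: (@measurable_fun_head_filter (fun a w => all _ _)) => a.
apply: (@measurable_fun_all (fun a' w => _ <= _)) => a'.
by apply: measurable_fun_ler; exact: measurable_pooled_mean.
Qed.

Lemma measurable_sdmmsa_index u :
  measurable_fun setT (fun w => sdmmsa_index (y w) u).
Proof.
elim: u => [|u IH] /=; first exact: measurable_cst.
apply: (measurable_fun_select (g := fun m w => block_start (y w) m.-1)) => // m.
exact: measurable_block_start.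
Qed.

Lemma measurable_sdmmsa g : measurable_fun setT (fun w => sdmmsa (y w) g).
Proof.
have mblock : measurable_fun setT (fun w => sdmmsa_block (y w) g).
  apply: (@measurable_fun_find (fun u w => (sdmmsa_index (y w) u <= g)%N)) => u.
  apply: (measurable_fun_select (g := fun m _ => (m <= g)%N)) => [|m].
    exact: measurable_sdmmsa_index.
  exact: measurable_cst.
apply: (measurable_fun_select (g := fun u w =>
  pooled_mean (y w) (sdmmsa_index (y w) u) (sdmmsa_index (y w) u.-1).-1)) => // u.
apply: (measurable_fun_select (g := fun a w =>
  pooled_mean (y w) a (sdmmsa_index (y w) u.-1).-1)) => [|a].
  exact: measurable_sdmmsa_index.
apply: (measurable_fun_select (g := fun m w => pooled_mean (y w) a m.-1)) => [|m].
  exact: measurable_sdmmsa_index.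
exact: measurable_pooled_mean.
Qed.

Lemma measurable_HB_ratio (delta : R) i :
  measurable_fun setT (fun w => HB_ratio (y w) delta i).
Proof.
apply: measurable_div_rmse; first exact: sqrtr_ge0.
apply: measurable_funB; last exact: measurable_cst.
by apply: measurable_funB; exact: measurable_mean.
Qed.

Lemma measurable_set_gt (t : R) (f : T -> R) :
  measurable_fun setT f -> measurable [set w | t < f w].
Proof.
move=> mf.
have mlt := measurable_fun_ltr (@measurable_cst _ _ _ _ setT t) mf.
by have := mlt measurableT [set true] I; rewrite setTI.
Qed.

Lemma measurable_HB_region (alpha delta : R) :
  measurable (y @^-1` HB_region alpha delta).
Proof.
apply: measurable_set_gt; apply: measurable_bigmin => [|i];
  exact: measurable_HB_ratio.
Qed.

Lemma measurable_stepup_region (alpha delta : R) :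
  measurable (y @^-1` stepup_region (n := n) alpha delta).
Proof.
apply: measurable_set_gt.
under eq_fun do rewrite -[rmse _]mulr1.
apply: measurable_div_rmse => //.
apply: measurable_funB; last exact: measurable_cst.
by apply: measurable_funB; [exact: measurable_sdmmsa|exact: measurable_mean].
Qed.

End measurability.

(** * Comparison of the tests *)

Lemma is_MED1 (R : realType) (k : nat) (mu : 'I_k.+1 -> R) (delta : R) :
  (0 < k)%N ->
  is_MED mu delta (inord 1) <-> mu (inord 1) > mu ord0 + delta.
Proof.
by move=> k0; split=> [[]//|mu1]; split; rewrite ?inordK.
Qed.

Theorem mainTheorem5 (R : realType) (k : nat) (n : 'I_k.+1 -> nat)
    (alpha delta : R)
    (hk : (0 < k)%N)
    (hn : forall i : 'I_k.+1, (0 < n i)%N)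
    (hnu : (0 < dof n)%N)
    (hbal : forall i : 'I_k.+1, n i = n ord0)
    (halpha : 0 < alpha < 1)
    (hdelta : 0 <= delta) :
  HB_region alpha delta `<=` stepup_region (n := n) alpha delta /\
  forall (mu : 'I_k.+1 -> R) (sigma : R),
    ordered_means mu -> 0 < sigma ->
    (is_MED mu delta (inord 1) <-> mu (inord 1) > mu ord0 + delta) /\
    (mu (inord 1) > mu ord0 + delta ->
     forall (d : measure_display) (T : measurableType d) (P : probability T R)
       (eps : forall i : 'I_k.+1, 'I_(n i) -> {RV P >-> R}),
       normal_errors sigma eps ->
       (P (observations mu eps @^-1` stepup_region (n := n) alpha delta) >=
        P (observations mu eps @^-1` HB_region (n := n) alpha delta))%E).
Proof.
have sub : HB_region alpha delta `<=` stepup_region (n := n) alpha delta.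
  by move=> y; exact: HB_region_sub_stepup.
split=> // mu sigma _ _; split; first exact: is_MED1.
move=> _ d T P eps _.
have mobs i j : measurable_fun setT (fun w => @observations _ _ _ _ _ _ mu eps w i j).
  by apply: measurable_funD; [exact: measurable_cst|exact: measurable_funPT].
apply: le_measure; rewrite ?inE.
- exact: measurable_HB_region.
- exact: measurable_stepup_region.
- by move=> w; exact: sub.
Qed.
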